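(* Let $\Omega$, $k$, $\mathcal{H}_k(\overline{\Omega})$, $\overline{P},\overline{B},L_i^P,L_j^B,f,g$ be as in the context, and suppose that the boundary value problem (PDE) admits at least one solution in $\mathcal{H}_k(\overline{\Omega})$. Let $\alpha\in(0,1)$ and let $(x_n)_{n\in\mathbb{N}}\subset\overline{\Omega}$ be an $\alpha$-weak greedy sequence with corresponding generalized interpolants $(u_n)_{n\in\mathbb{N}}\subset\mathcal{H}_k(\overline{\Omega})$ (both as defined in the context), such that for every $n$ the functionals in $\mathbf{X}(\{x_1,\dots,x_n\})$ are linearly independent. Then: a) $\operatorname{dist}_{\mathcal{H}_k(\overline{\Omega})}(u_n,S_k)\to 0$ as $n\to\infty$, where $S_k$ is the set of minimum-norm solutions of (PDE). b) If (PDE) admits a unique minimum-norm solution $u^\star\in\mathcal{H}_k(\overline{\Omega})$ (i.e. $S_k=\{u^\star\}$), then $u_n\to u^\star$ in the norm of $\mathcal{H}_k(\overline{\Omega})$.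
   Context: Setting. $\Omega\subset\mathbb{R}^d$ is a bounded open set with (compact) closure $\overline{\Omega}$ and boundary $\partial\Omega$. Let $\ell\in\mathbb{N}$. A positive definite kernel is a symmetric function $k:\overline{\Omega}\times\overline{\Omega}\to\mathbb{R}$ such that all matrices $(k(x_i,x_j))_{i,j=1}^n$, $x_1,\dots,x_n\in\overline{\Omega}$, are positive semi-definite; $\mathcal{H}_k(\overline{\Omega})$ denotes its reproducing kernel Hilbert space of functions $\overline{\Omega}\to\mathbb{R}$. Assume $k\in C^{2\ell}(\overline{\Omega}\times\overline{\Omega})$; then $\mathcal{H}_k(\overline{\Omega})\subset C^\ell(\overline{\Omega})$ and, for $|\alpha|\le\ell$, $\langle\partial_2^\alpha k(\cdot,x),v\rangle_{\mathcal{H}_k(\overline{\Omega})}=\partial^\alpha v(x)$ for all $v\in\mathcal{H}_k(\overline{\Omega})$, $x\in\overline{\Omega}$ ($\alpha$ here a multi-index; $\partial_2^\alpha$ is differentiation in the second argument; $C^\ell(\overline{\Omega})$ means derivatives up to order $\ell$ extend continuously to $\overline{\Omega}$, and values of derivatives on $\partial\Omega$ are those of the extensions). PDE. For $N\in\mathbb{N}$ write $[N]=\{1,\dots,N\}$. Let $\overline{P}:\mathbb{R}^Q\to\mathbb{R}$ and $\overline{B}:\mathbb{R}^R\to\mathbb{R}$ be continuous, let $L_1^P,\dots,L_Q^P$ and $L_1^B,\dots,L_R^B$ be linear differential operators of order at most $\ell$, i.e. linear combinations (with real constant coefficients) of partial derivatives of order at most $\ell$, and let $f:\Omega\to\mathbb{R}$,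 $g:\partial\Omega\to\mathbb{R}$ be given functions. The problem (PDE) is: $\overline{P}(L_1^Pu(x),\dots,L_Q^Pu(x))=f(x)$ for all $x\in\Omega$, and $\overline{B}(L_1^Bu(x),\dots,L_R^Bu(x))=g(x)$ for all $x\in\partial\Omega$. Minimum-norm solutions. $S_k$ is the set of those solutions $u\in\mathcal{H}_k(\overline{\Omega})$ of (PDE) whose norm $\|u\|_{\mathcal{H}_k(\overline{\Omega})}$ is minimal among all solutions of (PDE) in $\mathcal{H}_k(\overline{\Omega})$. For $u\in\mathcal{H}_k(\overline{\Omega})$, $\operatorname{dist}_{\mathcal{H}_k(\overline{\Omega})}(u,S_k)=\inf_{v\in S_k}\|u-v\|_{\mathcal{H}_k(\overline{\Omega})}$. Collocation. For a finite set $X=\{x_1,\dots,x_M\}\cup\{x_1',\dots,x_{M'}'\}$ with $x_i\in\Omega$, $x_j'\in\partial\Omega$ (either part may be empty), let $\mathbf{X}(X)=\{\delta_{x_i}^{L_q^P}: i\in[M],q\in[Q]\}\cup\{\delta_{x_j'}^{L_r^B}: j\in[M'],r\in[R]\}$, where $\delta_x^L:\mathcal{H}_k(\overline{\Omega})\to\mathbb{R}$, $\delta_x^L(u)=(Lu)(x)$. The optimal recovery problem (OR) corresponding to $X$ is: minimize $\|u\|_{\mathcal{H}_k(\overline{\Omega})}^2$ over $u\in\mathcal{H}_k(\overline{\Omega})$ subject to $\overline{P}(L_1^Pu(x_i),\dots,L_Q^Pu(x_i))=f(x_i)$ for $i\in[M]$ and $\overline{B}(L_1^Bu(x_j'),\dots,L_R^Bu(x_j'))=g(x_j')$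 for $j\in[M']$. Residuals. $R_P[u](x)=|\overline{P}(L_1^Pu(x),\dots,L_Q^Pu(x))-f(x)|$ for $x\in\Omega$, $R_B[u](x)=|\overline{B}(L_1^Bu(x),\dots,L_R^Bu(x))-g(x)|$ for $x\in\partial\Omega$. For $u\in\mathcal{H}_k(\overline{\Omega})$ define $\eta_u:\overline{\Omega}\to[0,\infty)$ by $\eta_u(x)=R_P[u](x)$ if $x\in\Omega$ and $\eta_u(x)=R_B[u](x)$ if $x\in\partial\Omega$ (when (PDE) has a solution in $\mathcal{H}_k(\overline{\Omega})$, $\eta_u$ is bounded). $\alpha$-weak greedy sequence. For $\alpha\in(0,1)$, an infinite sequence $(x_n)_{n\in\mathbb{N}}\subset\overline{\Omega}$ is an $\alpha$-weak greedy sequence, with corresponding generalized interpolants $(u_n)$, if with $u_0\equiv0$ the following holds for every $n\ge1$: $x_n\in\overline{\Omega}\setminus\{x_1,\dots,x_{n-1}\}$ satisfies $\eta_{u_{n-1}}(x_n)\ge\alpha\sup_{x\in\overline{\Omega}}\eta_{u_{n-1}}(x)$, and $u_n$ is a minimizer of (OR) corresponding to $X=\{x_1,\dots,x_n\}$, where each $x_i$ is used as an interior or a boundary collocation point according to whether it lies in $\Omega$ or in $\partial\Omega$. (Existence of the minimizers $u_n$ is part of the definition.) *)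

(* Defs.v *)
From HB Require Import structures.
From mathcomp Require Import all_boot all_order all_algebra.
From mathcomp Require Import sesquilinear.
From mathcomp Require Import all_classical all_reals all_analysis.

Set Implicit Arguments.
Unset Strict Implicit.
Unset Printing Implicit Defensive.

Import Order.TTheory GRing.Theory Num.Theory.
Import numFieldNormedType.Exports.

Local Open Scope classical_set_scope.
Local Open Scope ring_scope.

(* Points of R^n are row vectors 'rV[R]_n. A function on the closure of an open
   set U is a total function 'rV[R]_n -> R of which only the values on
   closure U are used. *)

Definition boundary (T : topologicalType) (A : set T) : set T :=
  closure A `\` A°.

Section Derivatives.
Context {R : realType} {n : nat}.
Implicit Types (U : set 'rV[R]_n) (f : 'rV[R]_n -> R) (w : seq 'I_n).

Definition pderiv w f : 'rV[R]_n -> R :=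
  foldr (fun i g => 'D_(delta_mx 0 i) g) f w.

(* C^m(closure U), U open: all iterated partial derivatives up to order m exist
   in U and extend continuously to closure U. For w = [::] the extension has to
   be f itself, as f is already given on closure U. *)
Definition Cm_closure U (m : nat) f : Prop :=
  [/\ {within closure U, continuous f},
      forall w i x, (size w < m)%N -> U x ->
        derivable (pderiv w f) x (delta_mx 0 i)
    & forall w, (size w <= m)%N -> exists F : 'rV[R]_n -> R,
        {within closure U, continuous F} /\ {in U, F =1 pderiv w f}].

Definition multiindex (l : nat) := {ffun 'I_n -> 'I_l.+1}.

Definition mi_order l (a : multiindex l) : nat := (\sum_(i < n) a i)%N.

Definition mi_word l (a : multiindex l) : seq 'I_n :=
  flatten [seq nseq (a i) i | i <- enum 'I_n].

(* Off U (i.e. on the boundary) the value is that of the continuous extension. *)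
Definition mderiv U l (a : multiindex l) f (x : 'rV[R]_n) : R :=
  let g := pderiv (mi_word a) f in
  if x \in U then g x else lim (g y @[y --> within U (nbhs x)]).

(* A linear differential operator of order at most l with constant coefficients
   is given by its coefficients; those of multi-indices of order > l are unused. *)
Definition diffop (l : nat) := multiindex l -> R.

Definition diffop_app U l (L : diffop l) f (x : 'rV[R]_n) : R :=
  \sum_(a : multiindex l | (mi_order a <= l)%N) L a * mderiv U a f x.

End Derivatives.
Arguments multiindex : clear implicits.
Arguments diffop : clear implicits.

Section Kernels.
Context {R : realType} {n : nat}.
Implicit Types (D : set 'rV[R]_n) (k : 'rV[R]_n -> 'rV[R]_n -> R).

Definition pd_kernel D k : Prop :=
  (forall x y, D x -> D y -> k x y = k y x) /\
  (forall (m : nat) (x : 'I_m -> 'rV[R]_n) (c : 'I_m -> R),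
    (forall i, D (x i)) ->
    0 <= \sum_(i < m) \sum_(j < m) c i * c j * k (x i) (x j)).

(* k as a function of the 2n variables (x, y), on U x U *)
Definition Cm_kernel (U : set 'rV[R]_n) (m : nat) k : Prop :=
  Cm_closure [set z : 'rV[R]_(n + n) | U (lsubmx z) /\ U (rsubmx z)] m
    (fun z => k (lsubmx z) (rsubmx z)).

(* The Hilbert space H, with inner product ip, is the reproducing kernel Hilbert
   space of k on D; ev u is the function D -> R that u : H stands for. *)
Record is_rkhs D k (H : completeNormedModType R) (ip : {dot H for idfun})
    (ev : H -> 'rV[R]_n -> R) : Prop := IsRKHS {
  rkhs_norm : forall u, ip u u = `|u| ^+ 2 ;
  rkhs_linear : forall a u v x, D x -> ev (a *: u + v) x = a * ev u x + ev v x ;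
  rkhs_inj : forall u v, {in D, ev u =1 ev v} -> u = v ;
  rkhs_reproducing : forall y, D y -> exists ky : H,
    {in D, ev ky =1 k ^~ y} /\ forall v, ip ky v = ev v y
}.

End Kernels.

Section Functionals.
Context {R : realType} {H : lmodType R}.

Definition lin_indep (F : set (H -> R)) : Prop :=
  forall (m : nat) (phi : 'I_m -> H -> R) (c : 'I_m -> R),
    injective phi -> (forall i, F (phi i)) ->
    (forall u, \sum_(i < m) c i * phi i u = 0) -> forall i, c i = 0.

End Functionals.

Section Minimization.
Context {R : realType} {H : normedModType R}.

Definition minimizers (J : H -> R) (S : set H) : set H :=
  [set u | S u /\ forall v, S v -> J u <= J v].

Definition dist_to (S : set H) (u : H) : \bar R :=
  ereal_inf [set (`|u - v|)%:E | v in S].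

End Minimization.

(* f is only used on the open set of the problem, g only on its boundary. *)
Record pde (R : realType) (d l Q M : nat) := Pde {
  pde_P : 'rV[R]_Q -> R ;
  pde_B : 'rV[R]_M -> R ;
  pde_LP : 'I_Q -> diffop R d l ;
  pde_LB : 'I_M -> diffop R d l ;
  pde_f : 'rV[R]_d -> R ;
  pde_g : 'rV[R]_d -> R
}.

Section Collocation.
Context {R : realType} {d l Q M : nat}.
Context (Omega : set 'rV[R]_d) (E : pde R d l Q M).
Context {H : completeNormedModType R} (ev : H -> 'rV[R]_d -> R).
Implicit Types (u : H) (x : 'rV[R]_d) (X : set 'rV[R]_d).

Definition lhs_P u x : R :=
  pde_P E (\row_q diffop_app Omega (pde_LP E q) (ev u) x).

Definition lhs_B u x : R :=
  pde_B E (\row_r diffop_app Omega (pde_LB E r) (ev u) x).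

Definition pde_solutions : set H :=
  [set u | (forall x, Omega x -> lhs_P u x = pde_f E x) /\
           (forall x, boundary Omega x -> lhs_B u x = pde_g E x)].

Definition min_norm_solutions : set H :=
  minimizers (fun u => `|u|) pde_solutions.

Definition collocation_functionals X : set (H -> R) :=
  [set phi | exists x q, [/\ X x, Omega x &
     phi = fun u => diffop_app Omega (pde_LP E q) (ev u) x]] `|`
  [set phi | exists x r, [/\ X x, boundary Omega x &
     phi = fun u => diffop_app Omega (pde_LB E r) (ev u) x]].

Definition collocation_feasible X : set H :=
  [set u | (forall x, X x -> Omega x -> lhs_P u x = pde_f E x) /\
           (forall x, X x -> boundary Omega x -> lhs_B u x = pde_g E x)].

Definition optimal_recovery X : set H :=
  minimizers (fun u => `|u| ^+ 2) (collocation_feasible X).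

Definition residual u x : R :=
  if x \in Omega then `|lhs_P u x - pde_f E x| else `|lhs_B u x - pde_g E x|.

End Collocation.

Section Greedy.
Context {R : realType} {d l Q M : nat}.
Context (Omega : set 'rV[R]_d) (E : pde R d l Q M).
Context {H : completeNormedModType R} (ev : H -> 'rV[R]_d -> R).

(* {x_1, ..., x_n}; sequences of points start at index 1 and x 0 is unused. *)
Definition first_points (x : nat -> 'rV[R]_d) (n : nat) : set 'rV[R]_d :=
  [set x i | i in [set i | (1 <= i <= n)%N]].

Definition weak_greedy (alpha : R) (x : nat -> 'rV[R]_d) (u : nat -> H) : Prop :=
  u 0%N = 0 /\
  forall n, [/\ closure Omega (x n.+1),
    ~ first_points x n (x n.+1),
    (alpha%:E *
       ereal_sup [set (residual Omega E ev (u n) y)%:E | y in closure Omega]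
     <= (residual Omega E ev (u n) (x n.+1))%:E)%E
    & optimal_recovery Omega E ev (first_points x n.+1) (u n.+1)].

End Greedy.

(* Main.v *)
Require Import Defs.
From HB Require Import structures.
From mathcomp Require Import all_boot all_order all_algebra.
From mathcomp Require Import sesquilinear.
From mathcomp Require Import all_classical all_reals all_analysis.
From mathcomp Require Import ring lra.

Set Implicit Arguments.
Unset Strict Implicit.
Unset Printing Implicit Defensive.

Import Order.TTheory GRing.Theory Num.Theory.
Import numFieldNormedType.Exports.

Local Open Scope classical_set_scope.
Local Open Scope ring_scope.

(** Every derivative of order at most [l] at a point is a bounded functional on
    the space: it is represented by a vector, and this vector depends
    continuously on the point, up to the boundary. This is all that the
    smoothness of the kernel is used for ([diffop_app_feature],
    [diffop_feature_continuous]). The vectors are the derivatives of the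
    feature map [x |-> k (., x)], and they exist because, by a double mean value
    theorem, the inner products of its difference quotients converge to a mixed
    derivative of [k]; a family whose Gram matrix converges to a constant is
    Cauchy ([gram_cvg]). The same criterion gives the extension to the closure.

    With these representers the convergence is a compactness argument. All
    [u n] have norm at most that of any solution, being minimizers under fewer
    constraints. Along an ultrafilter finer than [\oo], the new points
    [x n.+1] converge to some [z] in the compact closure, and [u n] converges
    weakly to some [b] ([weak_compactness]). Representers converge in norm, so
    the equation value of [u n] at [x n.+1] tends to that of [b] at [z]. Now
    [b] satisfies the equation at every collocation point, hence at [z], which
    is a limit of such points: the residual of [u n] at [x n.+1] tends to zero
    ([observe_collocation_cvg]). The weak greedy choice carries this over to
    every point, so [b] solves the problem. As [b] is a weak limit of vectors
    which are not longer than any solution, it has minimal norm, and then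
    [`|u n| <= `|b|] turns the weak convergence into norm convergence
    ([greedy_ultra_limit]). If the distance to the minimum-norm solutions did
    not tend to zero, an ultrafilter living on the indices with a large distance
    would contradict this ([greedy_near]). *)

(** * Weak compactness in a Hilbert space *)

Lemma ultra_fmap (S T : Type) (f : S -> T) (F : set_system S) :
  UltraFilter F -> UltraFilter (f @ F).
Proof.
move=> FU; split; first exact: fmap_proper_filter.
move=> G GP sFG; apply/seteqP; split => // A GA.
have [//|FnA] := in_ultra_setVsetC (f @^-1` A) FU.
have /sFG GnA : (f @ F) (~` A) by [].
by have := filter_ex (filterI GA GnA) => -[y []].
Qed.

Lemma bounded_ultra_cvg (R : realType) (T : Type) (F : set_system T)
    (f : T -> R) (C : R) :
  UltraFilter F -> (forall t, `|f t| <= C) -> cvg (f @ F).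
Proof.
move=> FU fC.
have := @segment_compact R (- C) C; rewrite compact_ultra => cptC.
have [|p [_ fp]] := cptC (f @ F) (ultra_fmap f FU).
  by apply: nearW => t; rewrite /= in_itv /= -ler_norml.
by apply/cvg_ex; exists p.
Qed.

Section HilbertSpace.
Context {R : realType} {H : completeNormedModType R} (ip : {dot H for idfun}).
Context (ip_norm : forall u, ip u u = `|u| ^+ 2).
Implicit Types u v w : H.

Lemma ip_sym u v : ip u v = ip v u.
Proof.
by rewrite (hermC (theta := idfun : {rmorphism R -> R}) ip) expr0 mul1r.
Qed.

Lemma ipDl u v w : ip (u + v) w = ip u w + ip v w.
Proof. exact: linearDl. Qed.

Lemma ipBl u v w : ip (u - v) w = ip u w - ip v w.
Proof. exact: linearBl. Qed.

Lemma ipZl a u w : ip (a *: u) w = a * ip u w.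
Proof. exact: linearZl_LR. Qed.

Lemma ipDr u v w : ip w (u + v) = ip w u + ip w v.
Proof. by rewrite ip_sym ipDl !(ip_sym w). Qed.

Lemma ipBr u v w : ip w (u - v) = ip w u - ip w v.
Proof. by rewrite ip_sym ipBl !(ip_sym w). Qed.

Lemma ipZr a u w : ip w (a *: u) = a * ip w u.
Proof. by rewrite ip_sym ipZl (ip_sym w). Qed.

Lemma ip0l w : ip 0 w = 0.
Proof. by rewrite -(subrr w) ipBl subrr. Qed.

Lemma ip_suml (I : Type) (r : seq I) (P : pred I) (f : I -> H) w :
  ip (\sum_(i <- r | P i) f i) w = \sum_(i <- r | P i) ip (f i) w.
Proof.
by apply: (big_morph (fun u => ip u w)) => [u v|]; rewrite ?ipDl ?ip0l.
Qed.

Lemma sqr_normB u v : `|u - v| ^+ 2 = ip u u - 2 * ip u v + ip v v.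
Proof. by rewrite -ip_norm !(ipBl, ipBr) (ip_sym v u); ring. Qed.

Lemma cauchy_schwarz u v : `|ip u v| <= `|u| * `|v|.
Proof.
have [->|v0] := eqVneq v 0; first by rewrite ip_sym ip0l !normr0 mulr0.
have vv0 : 0 < ip v v by rewrite ip_norm exprn_gt0 // normr_gt0.
suff : ip u v ^+ 2 <= ip u u * ip v v.
  rewrite -real_normK ?num_real // !ip_norm -exprMn.
  by rewrite ler_pXn2r // nnegrE mulr_ge0.
have := sqr_ge0 `|u - (ip u v / ip v v) *: v|.
rewrite sqr_normB !(ipZl, ipZr) -(pmulr_lge0 _ vv0).
suff -> : (ip u u - 2 * (ip u v / ip v v * ip u v) +
    ip u v / ip v v * (ip u v / ip v v * ip v v)) * ip v v =
    ip u u * ip v v - ip u v ^+ 2 by rewrite subr_ge0.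
by field; rewrite gt_eqF.
Qed.

Definition weak_cvg (T : Type) (F : set_system T) (g : T -> H) (b : H) :=
  forall h, ip h (g t) @[t --> F] --> ip h b.

(** Norm convergence on one side compensates for weak convergence on the other:
    [ip (f t - a) (g t)] vanishes because [g] is bounded. *)
Lemma cvg_ip_weak (T : Type) (F : set_system T) (f g : T -> H) (a b : H)
    (C : R) :
  Filter F -> f @ F --> a -> (forall t, `|g t| <= C) -> weak_cvg F g b ->
  ip (f t) (g t) @[t --> F] --> ip a b.
Proof.
move=> FF fa gC gb.
have -> : (fun t => ip (f t) (g t)) =
    (fun t => ip (f t - a) (g t) + ip a (g t)).
  by apply/funext => t; rewrite ipBl subrK.
rewrite -[ip a b]add0r; apply: cvgD (gb a).
apply: (@norm_cvg0 _ R^o).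
apply: (@squeeze_cvgr _ _ _ _ (fun=> 0) (fun t => `|f t - a| * C)).
- apply: nearW => t /=; rewrite normr_ge0 /=.
  by rewrite (le_trans (cauchy_schwarz _ _)) // ler_wpM2l.
- exact: cvg_cst.
- rewrite -(mul0r C); apply: cvgMr_tmp; rewrite -(normr0 H) -(subrr a).
  by apply: cvg_norm; apply: cvgB fa (cvg_cst _).
Qed.

Lemma cvg_ip (T : Type) (F : set_system T) (f g : T -> H) (a b : H) :
  Filter F -> f @ F --> a -> g @ F --> b ->
  ip (f t) (g t) @[t --> F] --> ip a b.
Proof.
move=> FF fa gb.
have polar u v : ip u v = 2^-1 * (`|u| * `|u| + `|v| * `|v| -
    `|u - v| * `|u - v|).
  by rewrite -!expr2 sqr_normB -!ip_norm; field.
rewrite polar; under eq_fun do rewrite polar.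
apply: cvgMl_tmp; apply: cvgB; [apply: cvgD|];
  by apply: cvgM; apply: cvg_norm => //; apply: cvgB.
Qed.

Lemma cvg_ipl (T : Type) (F : set_system T) (f : T -> H) (a v : H) :
  Filter F -> f @ F --> a -> ip (f t) v @[t --> F] --> ip a v.
Proof.
by move=> FF fa; apply: cvg_ip => //; apply: cvg_cst.
Qed.

(** Loeve's criterion: [|f s - f t|^2] is the combination
    [ip (f s) (f s) - 2 ip (f s) (f t) + ip (f t) (f t)] of Gram entries, which
    tends to [c - 2 c + c = 0], so [f] is Cauchy. No candidate for the limit is
    required. *)
Lemma gram_cvg (T : Type) (F : set_system T) (f : T -> H) (c : R) :
  ProperFilter F ->
  (forall e, 0 < e -> exists2 A, F A &
     forall s t, A s -> A t -> `|ip (f s) (f t) - c| <= e) ->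
  cvg (f @ F).
Proof.
move=> FP gram; apply/cauchy_cvgP/cauchy_exP => e e0.
have [|A FA Ac] := gram (e ^+ 2 / 8); first by rewrite divr_gt0 // exprn_gt0.
have [s As] := filter_ex FA; exists (f s).
apply: (@filterS _ F _ A) => // t At; rewrite /= -ball_normE /ball_ /=.
rewrite -(@ltr_pXn2r _ 2) ?nnegrE // ?ltW // sqr_normB.
have := Ac _ _ As As; have := Ac _ _ As At; have := Ac _ _ At At.
rewrite !ler_norml => /andP[? ?] /andP[? ?] /andP[? ?].
have : 0 < e ^+ 2 by rewrite exprn_gt0.
by lra.
Qed.

(** Riesz representation: [b] is the minimizer of [J u = |u|^2 - 2 phi u].
    Minimizing sequences are Cauchy by the parallelogram law, and the first
    order condition at the minimum is [phi h = ip h b]. *)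
Lemma riesz (phi : H -> R) (C : R) :
  (forall a u v, phi (a *: u + v) = a * phi u + phi v) ->
  (forall u, `|phi u| <= C * `|u|) ->
  exists b, forall h, phi h = ip h b.
Proof.
move=> phi_lin phiC.
pose J u := ip u u - 2 * phi u.
have phi0 : phi 0 = 0 by have := phi_lin (-1) 0 0; rewrite scaler0 addr0; lra.
have phiD u v : phi (u + v) = phi u + phi v.
  by rewrite -[u]scale1r phi_lin scale1r mul1r.
have phiZ a u : phi (a *: u) = a * phi u.
  by rewrite -[a *: u]addr0 phi_lin phi0 addr0.
have J_lb u : - C ^+ 2 <= J u.
  have := phiC u; rewrite ler_norml => /andP[_ h].
  have := sqr_ge0 (`|u| - C); rewrite /J ip_norm; nra.
pose m := inf (range J).
have infJ : has_inf (range J).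
  by split; [exists (J 0), 0 | exists (- C ^+ 2) => _ [u _ <-]].
have J_ge u : m <= J u by apply: ge_inf; [case: infJ | exists u].
have mid u v : `|u - v| ^+ 2 <= 2 * (J u - m) + 2 * (J v - m).
  have := J_ge (2^-1 *: (u + v)); rewrite sqr_normB /J !(ipZl, ipZr, phiZ).
  rewrite !(ipDl, ipDr, phiD) (ip_sym v u); lra.
have near_min n : exists u, J u < m + n.+1%:R^-1.
  have [|_ [u _ <-] Ju] := inf_adherent (eps := n.+1%:R^-1) _ infJ.
    by rewrite invr_gt0.
  by exists u.
have [f fP] := choice near_min.
have f_cvg : cvg (f @ \oo).
  apply/cauchy_cvgP/cauchy_exP => e e0.
  have e20 : 0 < e ^+ 2 / 4 by rewrite divr_gt0 // exprn_gt0.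
  have [N _ NP] : \forall n \near \oo, n.+1%:R^-1 < e ^+ 2 / 4 :> R.
    exact: near_infty_natSinv_lt (PosNum e20).
  exists (f N), N => // n /= Nn; rewrite -ball_normE /ball_ /=.
  rewrite -(@ltr_pXn2r _ 2) ?nnegrE // ?ltW //.
  have := NP _ (leqnn N); have := NP _ Nn => /= h1 h2.
  move: h1 h2 (mid (f N) (f n)) (fP n) (fP N).
  move: (n.+1%:R^-1) (N.+1%:R^-1) => a1 a2.
  move: (J (f n)) (J (f N)) => J1 J2; lra.
pose b := lim (f @ \oo); exists b => h.
have Jb : J b <= m.
  have phif : phi (f n) @[n --> \oo] --> phi b.
    apply/subr_cvg0; apply: (@norm_cvg0 _ R^o).
    apply: (@squeeze_cvgr _ _ _ _ (fun=> 0) (fun n => C * `|f n - b|)).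
    - apply: nearW => n; rewrite normr_ge0 /= -[- phi b]mulN1r -phiZ -phiD.
      by rewrite scaleN1r.
    - exact: cvg_cst.
    - rewrite -[0](mulr0 C); apply: cvgMl_tmp; rewrite -(normr0 H) -(subrr b).
      by apply: cvg_norm; apply: cvgB f_cvg (cvg_cst _).
  have Jf : J (f n) @[n --> \oo] --> J b.
    apply: cvgB; last exact: cvgMl_tmp.
    rewrite ip_norm expr2; under eq_fun do rewrite ip_norm expr2.
    by apply: cvgM; apply: cvg_norm.
  suff Jm : J (f n) @[n --> \oo] --> m by rewrite (cvg_unique _ Jf Jm).
  apply: (@squeeze_cvgr _ _ _ _ (fun=> m) (fun n => m + n.+1%:R^-1)).
  - by apply: nearW => n; rewrite J_ge /= ltW.
  - exact: cvg_cst.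
  - by rewrite -[X in _ --> X]addr0; apply: cvgD (cvg_cst _) (cvg_harmonic).
have key t : 0 <= t ^+ 2 * ip h h + 2 * t * (ip h b - phi h).
  have := le_trans Jb (J_ge (t *: h + b)).
  rewrite /J !(ipZl, ipZr, phiZ, ipDl, ipDr, phiD) (ip_sym b h); lra.
apply/eqP; rewrite -subr_eq0; apply/eqP.
(* The quadratic [key] in [t] would be minimal at [c / ip h h]; the shift by 1
   avoids dividing by zero and still forces [c = 0]. *)
have := key ((phi h - ip h b) / (ip h h + 1)).
have hh : 0 <= ip h h by rewrite ip_norm sqr_ge0.
have hh1 : 0 < ip h h + 1 by lra.
rewrite -(opprB (phi h)) -(pmulr_lge0 _ (exprn_gt0 2 hh1)).
move: (phi h - ip h b) (ip h h) hh hh1 => c A hh hh1.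
have -> : ((c / (A + 1)) ^+ 2 * A + 2 * (c / (A + 1)) * - c) * (A + 1) ^+ 2 =
    - (c ^+ 2 * (A + 2)) by field; rewrite gt_eqF.
have c20 := sqr_ge0 c => cA.
have /eqP : c ^+ 2 = 0 by nra.
by rewrite expf_eq0 /= => /eqP.
Qed.

(** Along an ultrafilter every bounded real family converges, so that [g] has a
    limit against each [h] without passing to subsequences; this limit is a
    bounded functional of [h], hence represented by a vector. *)
Lemma weak_compactness (T : Type) (F : set_system T) (g : T -> H) (C : R) :
  UltraFilter F -> (forall t, `|g t| <= C) -> exists b, weak_cvg F g b.
Proof.
move=> FU gC.
have ip_cvg h : cvg (ip h (g t) @[t --> F]).
  apply: (bounded_ultra_cvg (C := `|h| * C)) => t.
  by rewrite (le_trans (cauchy_schwarz _ _)) // ler_wpM2l.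
pose phi h := lim (ip h (g t) @[t --> F]).
have [||b phib] := @riesz phi C.
- move=> a u v; apply: cvg_lim => //.
  under eq_fun do rewrite ipDl ipZl.
  by apply: cvgD (ip_cvg v); apply: cvgMl_tmp (ip_cvg u).
- move=> u; rewrite mulrC; apply: (cvgr_to_le (cvg_norm (ip_cvg u))).
  apply: nearW => t; rewrite (le_trans (cauchy_schwarz _ _)) //.
  by rewrite ler_wpM2l.
- by exists b => h; rewrite -phib; apply: ip_cvg.
Qed.

Lemma weak_cvg_le (T : Type) (F : set_system T) (g : T -> H) (b : H) (C : R) :
  ProperFilter F -> 0 <= C -> (forall t, `|g t| <= C) -> weak_cvg F g b ->
  `|b| <= C.
Proof.
move=> FP C0 gC gb.
have [->|b0] := eqVneq b 0; first by rewrite normr0.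
rewrite -(@ler_pM2l _ `|b|) ?normr_gt0 // -expr2 -ip_norm.
apply: (cvgr_to_le (gb b)); apply: nearW => t.
rewrite (le_trans (ler_norm _)) // (le_trans (cauchy_schwarz _ _)) //.
by rewrite ler_wpM2l.
Qed.

(** Follows from [|b - g t|^2 <= 2 (|b|^2 - ip b (g t))]. *)
Lemma weak_to_norm_cvg (T : Type) (F : set_system T) (g : T -> H) (b : H) :
  ProperFilter F -> (forall t, `|g t| <= `|b|) -> weak_cvg F g b ->
  g @ F --> b.
Proof.
move=> FP gle gb; apply/cvgrPdist_lt => /= e e0.
have e20 : 0 < e ^+ 2 / 2 by rewrite divr_gt0 // exprn_gt0.
have /cvgrPdist_lt /(_ _ e20) := gb b; apply: filterS => t /=.
rewrite ltr_norml => /andP[_ bt].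
rewrite -(@ltr_pXn2r _ 2) ?nnegrE // ?ltW // sqr_normB.
have : ip (g t) (g t) <= ip b b by rewrite !ip_norm ler_pXn2r ?nnegrE.
lra.
Qed.
End HilbertSpace.

(** * Mean value theorem for second differences *)

Section MeanValue.
Context {R : realType}.

(** A form of the mean value theorem that does not depend on the sign of [h],
    as needed for two-sided difference quotients. *)
Lemma mvt_segment0 (g dg : R -> R) (h : R) :
  (forall s : R, `|s| <= `|h| -> is_derive s (1 : R) g (dg s)) ->
  exists2 s, `|s| <= `|h| & g h - g 0 = h * dg s.
Proof.
move=> gd.
have gc a b : (forall s, a <= s <= b -> `|s| <= `|h|) ->
    {within `[a, b], continuous g}.
  move=> ab; apply: derivable_within_continuous => s.
  by rewrite in_itv /= => /ab/gd [].
have [h0|/ltW h0] := leP 0 h.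
- have seg s : 0 <= s <= h -> `|s| <= `|h| by move=> ?; rewrite !ger0_norm; lra.
  have [||s] := @MVT_segment _ g dg 0 h h0.
  + by move=> s; rewrite in_itv /= => /andP[? ?]; apply/gd/seg; lra.
  + exact: gc.
  + rewrite in_itv /= => /seg sh gh; exists s => //.
    by rewrite gh subr0 mulrC.
- have seg s : h <= s <= 0 -> `|s| <= `|h|.
    by move=> ?; rewrite !ler0_norm; lra.
  have [||s] := @MVT_segment _ g dg h 0 h0.
  + by move=> s; rewrite in_itv /= => /andP[? ?]; apply/gd/seg; lra.
  + exact: gc.
  + rewrite in_itv /= => /seg sh gh; exists s => //.
    by rewrite -opprB gh; ring.
Qed.

Context {V : normedModType R}.
Implicit Types (G : V -> R) (a b v z : V).

Lemma is_derive_line G v z (s : R) : derivable G (s *: v + z) v ->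
  is_derive s (1 : R) (fun t : R => G (t *: v + z)) ('D_v G (s *: v + z)).
Proof.
set g := fun t : R => _ => dG.
have E : (fun h : R => h^-1 *: ((g \o shift s) (h *: (1 : R)) - g s)) =
    (fun h => h^-1 *: ((G \o shift (s *: v + z)) (h *: v) - G (s *: v + z))).
  apply/funext => h /=; rewrite /g /shift /=; congr (_ *: (G _ - _)).
  by rewrite addrA -scalerDl [h *: (1 : R)]mulr1.
by split; rewrite ?/derivable ?/derive E.
Qed.

Lemma mvt_line G v z (h : R) :
  (forall s, `|s| <= `|h| -> derivable G (s *: v + z) v) ->
  exists2 s, `|s| <= `|h| &
    G (h *: v + z) - G z = h * 'D_v G (s *: v + z).
Proof.
move=> dG.
have [s sh] := mvt_segment0 (fun s sh => is_derive_line (dG s sh)).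
by rewrite scale0r add0r; exists s.
Qed.

(** The mean value theorem is applied along [a] to the difference
    [G (. + h' *: b) - G], and then along [b] to ['D_a G]. Thus only the mixed
    derivative in this order occurs, and Schwarz's theorem is not involved. *)
Lemma mvt_double G a b z (h h' : R) :
  (forall s t, `|s| <= `|h| -> `|t| <= `|h'| ->
     derivable G (s *: a + (t *: b + z)) a) ->
  (forall s t, `|s| <= `|h| -> `|t| <= `|h'| ->
     derivable ('D_a G) (t *: b + (s *: a + z)) b) ->
  exists s t, [/\ `|s| <= `|h|, `|t| <= `|h'| &
    G (h *: a + (h' *: b + z)) - G (h' *: b + z) - (G (h *: a + z) - G z) =
    h * h' * 'D_b ('D_a G) (t *: b + (s *: a + z))].
Proof.
move=> da db.
pose g s := G (s *: a + (h' *: b + z)) - G (s *: a + z).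
pose dg s := 'D_a G (s *: a + (h' *: b + z)) - 'D_a G (s *: a + z).
have [s sh|s sh gE] := @mvt_segment0 g dg h.
  apply: is_deriveB; apply: is_derive_line; first exact: da.
  by have := da s 0 sh; rewrite scale0r add0r; apply; rewrite normr0.
have [t th|t th dgE] := @mvt_line ('D_a G) b (s *: a + z) h'; first exact: db.
exists s, t; split => //.
have -> : h * h' * 'D_b ('D_a G) (t *: b + (s *: a + z)) = h * dg s.
  by rewrite -mulrA -dgE /dg addrCA.
by rewrite -gE /g !scale0r !add0r; ring.
Qed.
End MeanValue.

(** * Differentiability of feature maps *)

Section RowMx.
Context {R : realType} {d : nat}.
Implicit Types x y : 'rV[R]_d.

Lemma ball_row_mx x y x' y' (e : R) :
  ball x e x' -> ball y e y' -> ball (row_mx x y) e (row_mx x' y').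
Proof.
move=> [e0 xx'] [_ yy']; split=> // i j.
case: (split_ordP j) => k ->; first by rewrite !row_mxEl; apply: xx'.
by rewrite !row_mxEr; apply: yy'.
Qed.

Lemma nbhs_row_mx x y (A : set 'rV[R]_(d + d)) : nbhs (row_mx x y) A ->
  exists2 e : R, 0 < e &
    forall x' y', ball x e x' -> ball y e y' -> A (row_mx x' y').
Proof.
move=> /nbhs_ballP[e /= e0 eA]; exists e => // x' y' xx' yy'.
by apply/eA/ball_row_mx.
Qed.

Lemma ball_line x (e s : R) (i : 'I_d) :
  `|s| < e -> ball x e (s *: delta_mx 0 i + x).
Proof.
move=> se; have e0 : 0 < e by apply: le_lt_trans se.
split => // i' j; rewrite -ball_normE /ball_ /= !mxE opprD addrC subrK normrN.
rewrite normrM (le_lt_trans _ se) // ler_piMr //.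
by case: (_ && _); rewrite ?normr1 ?normr0.
Qed.

Lemma scale_delta_lshift x y (s : R) (i : 'I_d) :
  s *: delta_mx 0 (lshift d i) + row_mx x y =
  row_mx (s *: delta_mx 0 i + x) y.
Proof.
apply/rowP => j; case: (split_ordP j) => k ->.
  rewrite [LHS]mxE !row_mxEl [RHS]mxE ![in LHS]mxE ![in RHS]mxE.
  by rewrite eqxx (inj_eq (@lshift_inj _ _)).
by rewrite [LHS]mxE !row_mxEr ![in LHS]mxE eqxx eq_rlshift mulr0 add0r.
Qed.

Lemma scale_delta_rshift x y (s : R) (i : 'I_d) :
  s *: delta_mx 0 (rshift d i) + row_mx x y =
  row_mx x (s *: delta_mx 0 i + y).
Proof.
apply/rowP => j; case: (split_ordP j) => k ->.
  by rewrite [LHS]mxE !row_mxEl ![in LHS]mxE eqxx eq_lrshift mulr0 add0r.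
rewrite [LHS]mxE !row_mxEr [RHS]mxE ![in LHS]mxE ![in RHS]mxE.
by rewrite eqxx (inj_eq (@rshift_inj _ _)).
Qed.

End RowMx.

Section FeatureMap.
Context {R : realType} {d : nat}.
Context {H : completeNormedModType R} (ip : {dot H for idfun}).
Context (ip_norm : forall u, ip u u = `|u| ^+ 2).
Context (U : set 'rV[R]_d) (U_open : open U).
Implicit Types (Phi : 'rV[R]_d -> H) (G : 'rV[R]_(d + d) -> R).

Local Notation quot Phi i x h :=
  (h^-1 *: (Phi (h *: delta_mx 0 i + x) - Phi x)).

(** The Gram kernel of [Phi] is a function of concatenated rows, because the
    partial derivatives of kernels are taken in these [d + d] variables. *)
Definition gram Phi G :=
  forall x y, U x -> U y -> ip (Phi x) (Phi y) = G (row_mx x y).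

(** The inner product of two difference quotients is a second difference of the
    Gram kernel divided by [h * h']. *)
Lemma gram_quotient Phi G (i : 'I_d) :
  let a : 'rV[R]_(d + d) := delta_mx 0 (lshift d i) in
  let b : 'rV[R]_(d + d) := delta_mx 0 (rshift d i) in
  gram Phi G ->
  (forall x y, U x -> U y -> derivable G (row_mx x y) a) ->
  (forall x y, U x -> U y -> derivable ('D_a G) (row_mx x y) b) ->
  (forall x y, U x -> U y ->
     {for row_mx x y, continuous ('D_b ('D_a G))}) ->
  forall x y, U x -> U y -> forall e : R, 0 < e -> exists2 r : R, 0 < r &
    forall h h', 0 < `|h| < r -> 0 < `|h'| < r ->
    `|ip (quot Phi i x h) (quot Phi i y h') - 'D_b ('D_a G) (row_mx x y)| <= e.
Proof.
move=> a b PhiG da db cont x y Ux Uy e e0.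
have /cvgrPdist_le /(_ _ e0) /nbhs_row_mx[r1 r10 r1P] := cont x y Ux Uy.
have /nbhs_ballP[r2 /= r20 r2P] : nbhs x U by apply: open_nbhs_nbhs.
have /nbhs_ballP[r3 /= r30 r3P] : nbhs y U by apply: open_nbhs_nbhs.
exists (Num.min r1 (Num.min r2 r3)); first by rewrite !lt_min r10 r20.
move=> h h'; rewrite !lt_min.
move=> /and4P[h0 hr1 hr2 hr3] /and4P[h'0 h'r1 h'r2 h'r3].
have Uxs s : `|s| <= `|h| -> U (s *: delta_mx 0 i + x).
  by move=> sh; apply/r2P/ball_line; apply: le_lt_trans hr2.
have Uyt t : `|t| <= `|h'| -> U (t *: delta_mx 0 i + y).
  by move=> th; apply/r3P/ball_line; apply: le_lt_trans h'r3.
have [s t|s t|s [t [sh th]]] := @mvt_double _ _ G a b (row_mx x y) h h'.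
- move=> sh th; rewrite scale_delta_rshift scale_delta_lshift.
  by apply: da; [apply: Uxs|apply: Uyt].
- move=> sh th; rewrite scale_delta_lshift scale_delta_rshift.
  by apply: db; [apply: Uxs|apply: Uyt].
rewrite !(scale_delta_rshift, scale_delta_lshift) -!PhiG //;
  try by [apply: Uxs|apply: Uyt].
set c := 'D_b _ (row_mx (_ + x) _) => hE.
have -> : ip (quot Phi i x h) (quot Phi i y h') = c.
  rewrite !(ipZl, ipZr, ipBl, ipBr).
  transitivity ((h * h')^-1 * (h * h' * c)).
    by rewrite -hE invfM; ring.
  by rewrite mulKf // mulf_neq0 // -normr_gt0.
rewrite distrC; apply: r1P; apply: ball_line.
  exact: le_lt_trans hr1.
exact: le_lt_trans h'r1.
Qed.

(** One differentiation of the feature map costs two of its Gram kernel, one in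
    each argument. The limit exists by Loeve's criterion: for small steps, the
    inner products of the quotients at [x] are close to the mixed derivative
    of the kernel at [(x, x)]. *)
Lemma feature_derivative Phi G (i : 'I_d) :
  let a : 'rV[R]_(d + d) := delta_mx 0 (lshift d i) in
  let b : 'rV[R]_(d + d) := delta_mx 0 (rshift d i) in
  gram Phi G ->
  (forall x y, U x -> U y -> derivable G (row_mx x y) a) ->
  (forall x y, U x -> U y -> derivable ('D_a G) (row_mx x y) b) ->
  (forall x y, U x -> U y ->
     {for row_mx x y, continuous ('D_b ('D_a G))}) ->
  (forall x, U x -> derivable Phi x (delta_mx 0 i)) /\
  gram ('D_(delta_mx 0 i) Phi) ('D_b ('D_a G)).
Proof.
move=> a b PhiG da db cont.
have quotE := gram_quotient PhiG da db cont.
have punctured (r : R) : 0 < r -> (0 : R)^' [set h | 0 < `|h| < r].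
  move=> r0; apply/nbhs_ballP; exists r => //= h; rewrite -ball_normE /=.
  by rewrite sub0r normrN normr_gt0 => -> ->.
have dPhi x : U x -> derivable Phi x (delta_mx 0 i).
  move=> Ux; apply: (gram_cvg ip_norm (c := 'D_b ('D_a G) (row_mx x x))).
  move=> e /(quotE _ _ Ux Ux)[r r0 rP].
  by exists [set h | 0 < `|h| < r]; [exact: punctured|exact: rP].
split=> // x y Ux Uy.
have lim1 : ip (quot Phi i x h) (quot Phi i y h) @[h --> 0^'] -->
    ip ('D_(delta_mx 0 i) Phi x) ('D_(delta_mx 0 i) Phi y).
  exact: cvg_ip (dPhi _ Ux) (dPhi _ Uy).
suff lim2 : ip (quot Phi i x h) (quot Phi i y h) @[h --> 0^'] -->
    'D_b ('D_a G) (row_mx x y) by rewrite (cvg_unique _ lim1 lim2).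
apply/cvgrPdist_le => e.
move=> /(quotE _ _ Ux Uy)[r r0 rP]; apply: filterS (punctured r r0) => h hr.
by rewrite distrC; apply: rP.
Qed.

End FeatureMap.

(** * Representers of derivatives up to the boundary *)

(** The filter [nbhs x] contains the point [x] itself, so that a limit along it
    can only be the value at [x]. *)
Lemma cvg_at_point (R : realType) (T : topologicalType) (V : normedModType R)
    (f : T -> V) (x : T) : cvg (f y @[y --> x]) -> f y @[y --> x] --> f x.
Proof.
move=> c; suff <- : lim (f y @[y --> x]) = f x by [].
apply/eqP; rewrite -subr_eq0 -normr_eq0; apply: contraT => ne.
have e0 : 0 < `|lim (f y @[y --> x]) - f x| by rewrite lt_def ne normr_ge0.
by have /cvgrPdist_lt /(_ _ e0) /nbhs_singleton := c; rewrite ltxx.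
Qed.

Lemma fmap_within_eq (S T : Type) (F : set_system S) (A : set S)
    (f g : S -> T) :
  Filter F -> (forall y, A y -> f y = g y) ->
  f y @[y --> within A F] = g y @[y --> within A F].
Proof.
move=> FF fg; apply/seteqP; split=> B /=; rewrite !nbhs_simpl /within /=.
  by apply: filterS => y fB Ay; rewrite /= -fg //; apply: fB.
by apply: filterS => y fB Ay; rewrite /= fg //; apply: fB.
Qed.

Section CmClosure.
Context {R : realType} {n : nat} (U : set 'rV[R]_n) (U_open : open U).
Context (m : nat) (f : 'rV[R]_n -> R) (f_Cm : Cm_closure U m f).
Implicit Types (w : seq 'I_n) (x : 'rV[R]_n).

Lemma pderiv_cvg_within w x : (size w <= m)%N -> closure U x ->
  cvg (pderiv w f y @[y --> within U (nbhs x)]).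
Proof.
move=> wm Ux; have [_ _ /(_ _ wm)[F [/subspace_continuousP Fc FE]]] := f_Cm.
apply/cvg_ex; exists (F x).
rewrite -(fmap_within_eq _ (f := F)); last by move=> y Uy; rewrite FE ?inE.
apply: cvg_trans (Fc x Ux).
by apply: cvg_app; apply: within_subset; apply: subset_closure.
Qed.

Lemma pderiv_continuous w x : (size w <= m)%N -> U x ->
  {for x, continuous (pderiv w f)}.
Proof.
move=> wm Ux; have Ux' : U° x by move/interior_id: U_open => ->.
have := pderiv_cvg_within wm (subset_closure Ux).
rewrite within_interior // => c.
exact: cvg_at_point c.
Qed.
End CmClosure.

Section FeatureWords.
Context {R : realType} {d : nat}.
Context {H : completeNormedModType R} (ip : {dot H for idfun}).
Context (ip_norm : forall u, ip u u = `|u| ^+ 2).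
Context (U : set 'rV[R]_d) (U_open : open U).
Context (k : 'rV[R]_d -> 'rV[R]_d -> R) (l : nat).
Context (k_Cm : Cm_kernel U (2 * l) k).
Context (ev : H -> 'rV[R]_d -> R) (Phi : 'rV[R]_d -> H).
Context (Phi_k : forall x y, U x -> U y -> ip (Phi x) (Phi y) = k x y).
Context (Phi_ev : forall x v, U x -> ip (Phi x) v = ev v x).
Implicit Types (w : seq 'I_d) (x y : 'rV[R]_d) (v : H).

Let UU : set 'rV[R]_(d + d) := [set z | U (lsubmx z) /\ U (rsubmx z)].
Let K (z : 'rV[R]_(d + d)) := k (lsubmx z) (rsubmx z).

(** Differentiating the feature map along [w] differentiates the kernel
    alternately in both arguments. Keeping the letters interleaved makes the
    kernel of each derivative a derivative of the previous one, with no exchange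
    of partial derivatives; order [2 * l] enters here. *)
Definition double_word w : seq 'I_(d + d) :=
  flatten [seq [:: rshift d i; lshift d i] | i <- w].

Lemma size_double_word w : size (double_word w) = (2 * size w)%N.
Proof. by elim: w => //= i w ->; rewrite mulnS. Qed.

Definition feature w : 'rV[R]_d -> H :=
  foldr (fun i F => 'D_(delta_mx 0 i) F) Phi w.

Lemma UU_row_mx x y : U x -> U y -> UU (row_mx x y).
Proof. by rewrite /UU /= row_mxKl row_mxKr. Qed.

Lemma UU_open : open UU.
Proof.
rewrite openE => z [Ul Ur].
have /nbhs_ballP[r /= r0 rU] : nbhs (lsubmx z) U by apply: open_nbhs_nbhs.
have /nbhs_ballP[s /= s0 sU] : nbhs (rsubmx z) U by apply: open_nbhs_nbhs.
apply/nbhs_ballP; exists (Num.min r s); first by rewrite /= lt_min r0.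
move=> z' [_ zz']; split.
  apply/rU; split=> // i j; rewrite !mxE.
  by apply: le_ball (zz' _ _); rewrite ge_min lexx.
apply/sU; split=> // i j; rewrite !mxE.
by apply: le_ball (zz' _ _); rewrite ge_min lexx orbT.
Qed.

(** The representer of [pderiv w] at [x] is the derivative along [w] of the
    feature map, by continuity of the inner product in its first argument. *)
Lemma feature_spec w : (size w <= l)%N ->
  gram ip U (feature w) (pderiv (double_word w) K) /\
  forall x v, U x -> ip (feature w x) v = pderiv w (ev v) x.
Proof.
elim: w => [_|i w IHw wl].
  split=> [x y Ux Uy|x v Ux]; last exact: Phi_ev.
  by rewrite /= /K row_mxKl row_mxKr; apply: Phi_k.
have [gramw evw] := IHw (ltnW wl).
have [_ dK _] := k_Cm.
have [dPhi gramiw] :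
    (forall x, U x -> derivable (feature w) x (delta_mx 0 i)) /\
    gram ip U (feature (i :: w)) (pderiv (double_word (i :: w)) K).
  apply: (feature_derivative ip_norm U_open gramw) => // x y Ux Uy.
  - apply: dK; last exact: UU_row_mx.
    by rewrite size_double_word ltn_mul2l.
  - apply: (dK (lshift d i :: double_word w)); last exact: UU_row_mx.
    rewrite /= size_double_word -[X in (X <= _)%N]/(2 + 2 * size w)%N.
    by rewrite -mulnS leq_mul2l.
  - apply: (pderiv_continuous UU_open k_Cm (w := double_word (i :: w))).
      by rewrite size_double_word leq_mul2l wl orbT.
    exact: UU_row_mx.
split=> // x v Ux /=.
rewrite -(near_eq_derive (f := fun y => ip (feature w y) v)); last first.
  by apply: filterS (open_nbhs_nbhs (conj U_open Ux)) => y Uy; apply: evw.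
have quot_cvg : ip (h^-1 *: (feature w (h *: delta_mx 0 i + x) - feature w x)) v
    @[h --> 0^'] --> ip ('D_(delta_mx 0 i) (feature w) x) v.
  exact: cvg_ipl (dPhi _ Ux).
apply/esym; rewrite /derive.
under eq_fun => h do rewrite /= -ipBl -[_ *: _]/(_ * _) -ipZl.
exact: cvg_lim quot_cvg.
Qed.

(** Loeve's criterion again, now at a boundary point: the Gram kernel extends
    continuously to [(x, x)]. *)
Lemma feature_cvg w x : (size w <= l)%N -> closure U x ->
  cvg (feature w y @[y --> within U (nbhs x)]).
Proof.
move=> wl Ux; have [gramw _] := feature_spec wl.
have UUx : closure UU (row_mx x x).
  move=> B /nbhs_row_mx[r r0 rB].
  have [y [Uy xy]] := Ux _ (nbhsx_ballx x r r0).
  by exists (row_mx y y); split; [exact: UU_row_mx|exact: rB].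
have dwl : (size (double_word w) <= 2 * l)%N.
  by rewrite size_double_word leq_mul2l wl orbT.
have := pderiv_cvg_within k_Cm dwl UUx => /cvgrPdist_le Kc.
apply: (gram_cvg ip_norm) => e /Kc /nbhs_row_mx[r r0 rP].
exists (U `&` ball x r).
  by apply: filterS (nbhsx_ballx x r r0) => y xy Uy.
move=> y z [Uy xy] [Uz xz]; rewrite gramw // distrC.
by apply: rP => //; apply: UU_row_mx.
Qed.

Definition closed_feature w x : H :=
  lim (feature w y @[y --> within U (nbhs x)]).

Lemma closed_featureE w x : (size w <= l)%N -> U x ->
  closed_feature w x = feature w x.
Proof.
move=> wl Ux; have := feature_cvg wl (subset_closure Ux).
rewrite /closed_feature within_interior; last by move/interior_id: U_open => ->.
by move=> /cvg_at_point c; exact: cvg_lim c.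
Qed.

Lemma size_mi_word (a : multiindex d l) : size (mi_word a) = mi_order a.
Proof.
rewrite size_flatten /shape -map_comp sumnE big_map big_enum.
by under eq_bigr do rewrite /= size_nseq.
Qed.

Lemma mderiv_feature (a : multiindex d l) x v :
  (mi_order a <= l)%N -> closure U x ->
  mderiv U a (ev v) x = ip (closed_feature (mi_word a) x) v.
Proof.
move=> al Ux; have wl : (size (mi_word a) <= l)%N.
  by rewrite size_mi_word.
have [_ evw] := feature_spec wl.
rewrite /mderiv; case: ifPn => [/set_mem Ux'|_].
  by rewrite closed_featureE // evw.
apply: cvg_lim; first exact: Rhausdorff.
rewrite -(fmap_within_eq _ (fun y Uy => evw y v Uy)).
exact: cvg_ipl (feature_cvg wl Ux).
Qed.

(** Regularity of limits: [closed_feature w y] is the limit of interior values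
    near [y], and these are within [e] of [closed_feature w x] when [y] is near
    [x]. *)
Lemma closed_feature_continuous w x : (size w <= l)%N -> closure U x ->
  closed_feature w y @[y --> within (closure U) (nbhs x)] -->
    closed_feature w x.
Proof.
move=> wl Ux; apply/cvgrPdist_le => e e0.
have /cvgrPdist_le /(_ _ e0) := feature_cvg wl Ux.
move=> /nbhs_ballP[r /= r0 rP]; apply/nbhs_ballP; exists r => // y xy Uy /=.
have norm_cvg : `|closed_feature w x - feature w z| @[z --> within U (nbhs y)]
    --> `|closed_feature w x - closed_feature w y|.
  by apply: cvg_norm; apply: cvgB (cvg_cst _) (feature_cvg wl Uy).
apply: (cvgr_to_le norm_cvg); first exact: within_nbhs_proper.
have xy' : nbhs y (ball x r).
  by apply: open_nbhs_nbhs; split=> //; apply: ball_open.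
by apply: filterS xy' => z xz Uz; apply: rP.
Qed.

Definition diffop_feature (L : diffop R d l) x : H :=
  \sum_(a : multiindex d l | (mi_order a <= l)%N)
    L a *: closed_feature (mi_word a) x.

Lemma diffop_app_feature (L : diffop R d l) x v : closure U x ->
  diffop_app U L (ev v) x = ip (diffop_feature L x) v.
Proof.
move=> Ux; rewrite ip_suml; apply: eq_bigr => a al.
by rewrite ipZl mderiv_feature.
Qed.

Lemma diffop_feature_continuous (L : diffop R d l) x : closure U x ->
  diffop_feature L y @[y --> within (closure U) (nbhs x)] -->
    diffop_feature L x.
Proof.
move=> Ux; apply: cvg_big => [|a al]; first exact: add_continuous.
apply: cvgZl_tmp; apply: closed_feature_continuous => //.
by rewrite size_mi_word.
Qed.

End FeatureWords.

(** * Limits of collocated equations *)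

Lemma cvg_row (R : realType) (T : Type) (F : set_system T) (n : nat)
    (f : 'I_n -> T -> R) (a : 'I_n -> R) :
  Filter F -> (forall i, f i t @[t --> F] --> a i) ->
  (\row_i f i t : 'rV[R]_n) @[t --> F] --> (\row_i a i : 'rV[R]_n).
Proof.
move=> FF fa A /nbhs_ballP[e /= e0 eA].
apply: (@filterS _ F FF [set t | forall i, ball (a i) e (f i t)]).
  by move=> t ft; apply: eA; split=> // i j; rewrite !mxE; exact: ft.
by apply: filter_forall => i; apply: fa; apply: nbhsx_ballx.
Qed.

Section Observations.
Context {R : realType} {V : topologicalType}.
Context {H : completeNormedModType R} (ip : {dot H for idfun}).
Context (ip_norm : forall u, ip u u = `|u| ^+ 2).
Context (D : set V) (N : nat) (P : 'rV[R]_N -> R) (P_cont : continuous P).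
Context (T : 'I_N -> V -> H).
Context (T_cont : forall q x, D x ->
  T q y @[y --> within D (nbhs x)] --> T q x).

(** The left-hand side of either equation, seen as a function of finitely many
    bounded functionals of [u] which vary continuously with the point. *)
Definition observe (u : H) (x : V) : R := P (\row_q ip (T q x) u).

Lemma observe_cvg (I : Type) (F : set_system I) (g : I -> H) (b : H) (C : R)
    (y : I -> V) (z : V) :
  Filter F -> (forall n, `|g n| <= C) -> weak_cvg ip F g b ->
  D z -> y @ F --> z -> (forall n, D (y n)) ->
  observe (g n) (y n) @[n --> F] --> observe b z.
Proof.
move=> FF gC gb Dz yz Dy.
suff row_cvg : (\row_q ip (T q (y n)) (g n) : 'rV[R]_N) @[n --> F] -->
    (\row_q ip (T q z) b : 'rV[R]_N) by
  exact: (@continuous_cvg _ _ _ F FF _ P _ (@P_cont _) row_cvg).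
apply: cvg_row => q; apply: (cvg_ip_weak ip_norm FF _ gC gb) => A TA.
have TzA : nbhs z [set w | D w -> A (T q w)] by apply: (T_cont Dz TA).
apply: (@filterS _ F FF (y @^-1` [set w | D w -> A (T q w)])); last exact: yz.
by move=> n; apply.
Qed.

(** The collocation points themselves accumulate at the limit [z] of the new
    points. The weak limit [b] agrees with [v] at all collocation points in [S],
    and so at [z]; and both observations at [x n.+1] tend to those at [z].
    The set [S] is where the equation is imposed; [z] may be outside of [S],
    as interior points can accumulate on the boundary. *)
Lemma observe_collocation_cvg (F : set_system nat) (x : nat -> V) (z : V)
    (u : nat -> H) (b v : H) (C : R) (S : set V) :
  ProperFilter F -> \oo `<=` F ->
  D z -> x n.+1 @[n --> F] --> z -> (forall n, D (x n.+1)) ->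
  (forall n, `|u n| <= C) -> weak_cvg ip F u b ->
  F [set n | S (x n.+1)] ->
  (forall n m, (m < n)%N -> S (x m.+1) ->
     observe (u n) (x m.+1) = observe v (x m.+1)) ->
  observe (u n) (x n.+1) - observe v (x n.+1) @[n --> F] --> (0 : R).
Proof.
move=> FP Foo Dz xz Dx uC ub FS collocated.
have bE m : S (x m.+1) -> observe b (x m.+1) = observe v (x m.+1).
  move=> Sm; have l1 : observe (u n) (x m.+1) @[n --> F] --> observe b (x m.+1).
    exact: observe_cvg FP uC ub (Dx m) (cvg_cst _) (fun=> Dx m).
  suff l2 : observe (u n) (x m.+1) @[n --> F] --> observe v (x m.+1).
    by rewrite (cvg_unique _ l1 l2).
  apply: cvg_near_cst; apply: Foo; exists m.+1 => // n mn.
  exact: collocated.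
have cst_weak h : weak_cvg ip F (fun=> h) h by move=> g; apply: cvg_cst.
have lv : observe v (x n.+1) @[n --> F] --> observe v z.
  exact: (observe_cvg (g := fun=> v) FP (fun=> lexx _) (cst_weak v) Dz xz Dx).
have lb : observe b (x n.+1) @[n --> F] --> observe b z.
  exact: (observe_cvg (g := fun=> b) FP (fun=> lexx _) (cst_weak b) Dz xz Dx).
have bz : observe b z = observe v z.
  suff lb' : observe b (x n.+1) @[n --> F] --> observe v z.
    by rewrite (cvg_unique _ lb lb').
  by apply: cvg_trans lv; apply: near_eq_cvg; apply: filterS FS => n /bE.
rewrite -(subrr (observe v z)); apply: cvgB lv; rewrite -bz.
exact: observe_cvg FP uC ub Dz xz Dx.
Qed.

End Observations.

(** * Convergence of the weak greedy method *)

Lemma bounded_closure (R : realFieldType) (V : normedModType R) (A : set V) :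
  bounded_set A -> bounded_set (closure A).
Proof.
move=> bA; suff : \forall C \near +oo, forall x, closure A x -> `|x| <= C by [].
near=> C => x Ax.
have AC : forall y, A y -> `|y| <= C by near: C.
rewrite -normrN -sub0r.
have : closed (closed_ball_ Num.norm (0 : V) C) by apply: closed_closed_ball_.
apply; apply: closureS Ax => y Ay.
by rewrite /closed_ball_ /= sub0r normrN; apply: AC.
Unshelve. all: by end_near. Qed.

(* Of the kernel only the representers [T] of the differential operators
   matter from here on. *)
Section GreedyLimit.
Context {R : realType} {d l Q M : nat}.
Context (Omega : set 'rV[R]_d).
Context (Omega_open : open Omega) (Omega_bounded : bounded_set Omega).
Context (H : completeNormedModType R) (ip : {dot H for idfun}).
Context (ip_norm : forall u, ip u u = `|u| ^+ 2).
Context (ev : H -> 'rV[R]_d -> R) (E : pde R d l Q M).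
Context (P_cont : continuous (pde_P E)) (B_cont : continuous (pde_B E)).
Context (T : diffop R d l -> 'rV[R]_d -> H).
Context (T_app : forall L x v, closure Omega x ->
  diffop_app Omega L (ev v) x = ip (T L x) v).
Context (T_cont : forall L x, closure Omega x ->
  T L y @[y --> within (closure Omega) (nbhs x)] --> T L x).
Context (alpha : R) (alpha_gt0 : 0 < alpha).
Context (x : nat -> 'rV[R]_d) (u : nat -> H).
Context (xu_greedy : weak_greedy Omega E ev alpha x u).

Let obs_P := observe ip (pde_P E) (fun q => T (pde_LP E q)).
Let obs_B := observe ip (pde_B E) (fun r => T (pde_LB E r)).

Lemma lhs_P_observe v y : closure Omega y -> lhs_P Omega E ev v y = obs_P v y.
Proof.
by move=> Dy; congr (pde_P E _); apply/rowP => q; rewrite !mxE T_app.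
Qed.

Lemma lhs_B_observe v y : closure Omega y -> lhs_B Omega E ev v y = obs_B v y.
Proof.
by move=> Dy; congr (pde_B E _); apply/rowP => q; rewrite !mxE T_app.
Qed.

Lemma boundaryE y : boundary Omega y <-> closure Omega y /\ ~ Omega y.
Proof. by rewrite /boundary (interior_id Omega).1. Qed.

(** The data [f] and [g] are arbitrary functions; writing them as the values of
    a solution [v] gives them the continuity that the limits require. *)
Lemma residual_observe v w y : pde_solutions Omega E ev v -> closure Omega y ->
  residual Omega E ev w y =
  if y \in Omega then `|obs_P w y - obs_P v y| else `|obs_B w y - obs_B v y|.
Proof.
move=> [vP vB] Dy; rewrite /residual; case: ifPn => [/set_mem Oy|/negP Oy].
  by rewrite -vP // !lhs_P_observe.
rewrite -vB ?lhs_B_observe //; apply/boundaryE; split=> // Oy'.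
by apply: Oy; rewrite inE.
Qed.

Lemma residual0_solution w :
  (forall y, closure Omega y -> residual Omega E ev w y = 0) ->
  pde_solutions Omega E ev w.
Proof.
move=> res0; split=> y.
  move=> Oy; have := res0 y (subset_closure Oy).
  by rewrite /residual mem_set // => /normr0_eq0/subr0_eq.
move=> /boundaryE[Dy Oy]; have := res0 y Dy.
by rewrite /residual memNset // => /normr0_eq0/subr0_eq.
Qed.

Lemma greedy_point n : closure Omega (x n.+1).
Proof. by have [_ /(_ n)[]] := xu_greedy. Qed.

Lemma greedy_norm_le v n : pde_solutions Omega E ev v -> `|u n| <= `|v|.
Proof.
move=> [vP vB]; have [u0 greedy] := xu_greedy.
case: n => [|n]; first by rewrite u0 normr0.
have [_ _ _ [_ /(_ v)]] := greedy n.
by rewrite ler_pXn2r ?nnegrE //; apply; split=> y _; [exact: vP|exact: vB].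
Qed.

Lemma greedy_collocated v n m : pde_solutions Omega E ev v -> (m < n)%N ->
  (Omega (x m.+1) -> obs_P (u n) (x m.+1) = obs_P v (x m.+1)) /\
  (~ Omega (x m.+1) -> obs_B (u n) (x m.+1) = obs_B v (x m.+1)).
Proof.
move=> [vP vB]; have [u0 greedy] := xu_greedy.
case: n => // n mn; have [_ _ _ [[uP uB] _]] := greedy n.
have Xm : first_points x n.+1 (x m.+1) by exists m.+1.
have Dm := @greedy_point m.
rewrite -!lhs_P_observe // -!lhs_B_observe //; split=> Om.
  by rewrite uP // vP.
by have /boundaryE bm := conj Dm Om; rewrite uB // vB.
Qed.

Lemma greedy_residual_le n y : closure Omega y ->
  alpha * residual Omega E ev (u n) y <= residual Omega E ev (u n) (x n.+1).
Proof.
move=> Dy; have [_ /(_ n)[_ _ + _]] := xu_greedy; rewrite -lee_fin EFinM.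
apply: le_trans; apply: lee_wpmul2l; first by rewrite lee_fin ltW.
by apply: ereal_sup_ubound; exists y.
Qed.

Lemma residual_ge0 v y : 0 <= residual Omega E ev v y.
Proof. by rewrite /residual; case: ifP. Qed.

Lemma greedy_ultra_limit (F : set_system nat) :
  UltraFilter F -> \oo `<=` F -> pde_solutions Omega E ev !=set0 ->
  exists2 b, min_norm_solutions Omega E ev b & u @ F --> b.
Proof.
move=> FU Foo [v v_sol].
have Dx n : closure Omega (x n.+1) by apply: greedy_point.
have uv n : `|u n| <= `|v| by apply: greedy_norm_le.
have [b ub] := weak_compactness ip_norm FU uv.
have [z Dz xz] : exists2 z, closure Omega z & x n.+1 @[n --> F] --> z.
  have : compact (closure Omega).
    apply: bounded_closed_compact; last exact: closed_closure.
    exact: bounded_closure.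
  rewrite compact_ultra => cpt.
  have [|z [Dz xz]] := cpt _ (ultra_fmap (fun n => x n.+1) FU).
    by apply: nearW => n /=; apply: Dx.
  by exists z.
have res_x : residual Omega E ev (u n) (x n.+1) @[n --> F] --> (0 : R).
  have obs0 N (P : 'rV[R]_N -> R) (P_c : continuous P) L S :
      F [set n | S (x n.+1)] ->
      (forall n m, (m < n)%N -> S (x m.+1) ->
        observe ip P (fun q => T (L q)) (u n) (x m.+1) =
        observe ip P (fun q => T (L q)) v (x m.+1)) ->
      `|observe ip P (fun q => T (L q)) (u n) (x n.+1) -
        observe ip P (fun q => T (L q)) v (x n.+1)| @[n --> F] --> (0 : R).
    move=> FS coll; rewrite -(normr0 R); apply: cvg_norm.
    exact: (observe_collocation_cvg ip_norm P_c (fun q => @T_cont (L q)) _ Foo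
      Dz xz Dx uv ub FS coll).
  (* The ultrafilter decides whether the new points are eventually interior or
     eventually on the boundary. *)
  have [FO|FO] := in_ultra_setVsetC [set n | Omega (x n.+1)] FU.
  - apply: cvg_trans (obs0 _ _ P_cont (pde_LP E) Omega FO _); last first.
      by move=> n m mn; apply: (greedy_collocated v_sol mn).1.
    apply: near_eq_cvg; apply: filterS FO => n On.
    by rewrite (residual_observe _ v_sol) // mem_set.
  - apply: cvg_trans (obs0 _ _ B_cont (pde_LB E) (~` Omega) FO _); last first.
      by move=> n m mn; apply: (greedy_collocated v_sol mn).2.
    apply: near_eq_cvg; apply: filterS FO => n On.
    by rewrite (residual_observe _ v_sol) // memNset.
have b_sol : pde_solutions Omega E ev b.
  apply: residual0_solution => y Dy.
  have res0 : residual Omega E ev (u n) y @[n --> F] --> (0 : R).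
    apply: (@squeeze_cvgr _ _ _ _ (fun=> 0)
      (fun n => alpha^-1 * residual Omega E ev (u n) (x n.+1))).
    + apply: nearW => n; rewrite residual_ge0 /= ler_pdivlMl //.
      exact: greedy_residual_le.
    + exact: cvg_cst.
    + by rewrite -(mulr0 alpha^-1); apply: cvgMl_tmp.
  suff resb : residual Omega E ev (u n) y @[n --> F] -->
      residual Omega E ev b y.
    by rewrite (cvg_unique _ resb res0).
  rewrite (residual_observe _ v_sol) //.
  under eq_fun do rewrite (residual_observe _ v_sol) //.
  case: ifP => _; apply: cvg_norm; apply: cvgB (cvg_cst _).
    exact: (observe_cvg ip_norm P_cont (fun q => @T_cont (pde_LP E q)) _ uv ub
      Dy (cvg_cst _) (fun=> Dy)).
  exact: (observe_cvg ip_norm B_cont (fun q => @T_cont (pde_LB E q)) _ uv ub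
    Dy (cvg_cst _) (fun=> Dy)).
have b_min w : pde_solutions Omega E ev w -> `|b| <= `|w|.
  by move=> w_sol; apply: (weak_cvg_le ip_norm _ _ _ ub) => // n;
    apply: greedy_norm_le.
exists b; first by split.
by apply: (weak_to_norm_cvg ip_norm _ _ ub) => n; apply: greedy_norm_le.
Qed.

(** An ultrafilter finer than [\oo] and containing the indices for which the
    conclusion fails would have a limit that is a minimum-norm solution. *)
Lemma greedy_near (e : R) : pde_solutions Omega E ev !=set0 -> 0 < e ->
  \forall n \near \oo,
    exists2 v, min_norm_solutions Omega E ev v & `|u n - v| < e.
Proof.
move=> sol e0; set good := (X in \forall n \near _, X n).
apply: contrapT => ngood.
have FP : ProperFilter (within (~` good) (\oo : set_system nat)).
  apply: Build_ProperFilter_ex => A oA; apply: contrapT => A0.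
  have oA' : \oo [set n | ~ good n -> A n] by exact: oA.
  apply: ngood; apply: filterS oA' => n An; apply: contrapT => gn.
  by apply: A0; exists n; apply: An.
have [F [FU badF]] := ultraFilterLemma FP.
have Foo : \oo `<=` F by move=> A oA; apply: badF; apply: cvg_within oA.
have [b b_min /cvgrPdist_lt /(_ _ e0) Fb] := greedy_ultra_limit FU Foo sol.
have Fbad : F (~` good) by apply: badF; apply: withinT.
have [n [bad_n bn]] := filter_ex (filterI Fbad Fb).
by apply: bad_n; exists b => //; rewrite distrC.
Qed.

End GreedyLimit.

Theorem theorem4p5 (R : realType) (d l Q M : nat)
  (Omega : set 'rV[R]_d)
  (Omega_open : open Omega) (Omega_bounded : bounded_set Omega)
  (k : 'rV[R]_d -> 'rV[R]_d -> R)
  (k_pd : pd_kernel (closure Omega) k) (k_C2l : Cm_kernel Omega (2 * l) k)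
  (H : completeNormedModType R) (ip : {dot H for idfun})
  (ev : H -> 'rV[R]_d -> R) (H_rkhs : is_rkhs (closure Omega) k ip ev)
  (E : pde R d l Q M)
  (P_cont : continuous (pde_P E)) (B_cont : continuous (pde_B E))
  (solvable : pde_solutions Omega E ev !=set0)
  (alpha : R) (alpha01 : 0 < alpha < 1)
  (x : nat -> 'rV[R]_d) (u : nat -> H)
  (xu_greedy : weak_greedy Omega E ev alpha x u)
  (x_indep : forall n,
     lin_indep (collocation_functionals Omega E ev (first_points x n))) :
  (dist_to (min_norm_solutions Omega E ev) (u n) @[n --> \oo] --> 0%E) /\
  (forall ustar : H,
     min_norm_solutions Omega E ev = [set ustar] -> u n @[n --> \oo] --> ustar).
Proof.
have [ip_norm _ _ repr] := H_rkhs.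
have repr_ex y : exists ky : H, closure Omega y ->
    {in closure Omega, ev ky =1 k ^~ y} /\ forall v, ip ky v = ev v y.
  have [/repr[ky kyP]|nDy] := pselect (closure Omega y); first by exists ky.
  by exists 0.
have [Phi PhiP] := choice repr_ex.
have Phi_ev y v : Omega y -> ip (Phi y) v = ev v y.
  by move=> /subset_closure/PhiP[].
have Phi_k y z : Omega y -> Omega z -> ip (Phi y) (Phi z) = k y z.
  move=> Oy Oz; rewrite Phi_ev //.
  by apply: (PhiP _ (subset_closure Oz)).1; rewrite inE; apply: subset_closure.
have [alpha_gt0 _] := andP alpha01.
have near_min e : 0 < e -> \forall n \near \oo,
    exists2 v, min_norm_solutions Omega E ev v & `|u n - v| < e.
  move=> e0; apply: (@greedy_near _ _ _ _ _ Omega _ _ _ ip _ ev E _ _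
    (diffop_feature Omega Phi) _ _ alpha _ x) => //.
  - by move=> L y v; apply: (diffop_app_feature ip_norm Omega_open k_C2l).
  - move=> L y.
    exact: (diffop_feature_continuous ip_norm Omega_open k_C2l Phi_k Phi_ev).
split; last first.
  move=> ustar minE; apply/cvgrPdist_lt => e /near_min.
  by apply: filterS => n [v]; rewrite minE => ->; rewrite distrC.
have dist_ge0 n : (0 <= dist_to (min_norm_solutions Omega E ev) (u n))%E.
  by apply/ereal_infP => _ [v _ <-]; rewrite lee_fin.
have dist_le e : 0 < e -> \forall n \near \oo,
    (dist_to (min_norm_solutions Omega E ev) (u n) <= e%:E)%E.
  move=> /near_min; apply: filterS => n [v v_min /ltW uv].
  apply: le_trans (_ : (`|u n - v|%:E <= e%:E)%E); last by rewrite lee_fin.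
  by apply: ereal_inf_lbound; exists v.
apply/fine_cvgP; split.
  apply: filterS (dist_le 1 ltr01) => n n1.
  by rewrite ge0_fin_numE // (le_lt_trans n1) // ltry.
apply/cvgrPdist_le => e e0; apply: filterS (dist_le e e0) => n /=.
rewrite sub0r normrN; have := dist_ge0 n.
case: (dist_to _ _) => [r| |] //=; rewrite !lee_fin => r0 re.
by rewrite ger0_norm.
Qed.
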